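(* Let $G$ be a finite simple connected graph with at least one edge, with $n$ vertices, maximum degree $\Delta$ and minimum degree $\delta$. Then $$\frac{\delta M_1(G)}{2\Delta^2} \le GA_1(G) \le \frac{\sqrt{n M_1(G)}}{2},$$ and each of the two equalities holds if and only if $G$ is a regular graph.
   Context: For a graph $G$ with vertex set $V(G)$ and edge set $E(G)$, $d_u$ denotes the degree of the vertex $u$. The first geometric-arithmetic index is $GA_1(G)=\sum_{uv\in E(G)}\frac{2\sqrt{d_ud_v}}{d_u+d_v}$. The first Zagreb index is $M_1(G)=\sum_{u\in V(G)} d_u^2$. *)

(* Defs.v *)
From mathcomp Require Import all_boot all_order all_algebra.

Set Implicit Arguments.
Unset Strict Implicit.
Unset Printing Implicit Defensive.

Import Order.TTheory GRing.Theory Num.Theory.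

(* A finite simple graph is an adjacency relation [e] on a finite type [T]
   that is symmetric and irreflexive; its vertex set is the whole of [T]. *)

Definition simple_graph (T : finType) (e : rel T) : Prop :=
  symmetric e /\ irreflexive e.

Definition edge_set (T : finType) (e : rel T) : {set {set T}} :=
  [set a : {set T} | [exists u, exists v, e u v && (a == [set u; v])]].

Definition connected_graph (T : finType) (e : rel T) : Prop :=
  forall u v : T, connect e u v.

Definition degree (T : finType) (e : rel T) (u : T) : nat :=
  #|[set v | e u v]|.

Definition max_degree (T : finType) (e : rel T) : nat :=
  \max_(u : T) degree e u.

(* No degree exceeds #|T|, so starting the iterated minimum at #|T| does not
   affect its value when T is nonempty. *)
Definition min_degree (T : finType) (e : rel T) : nat :=
  \big[minn/#|T|]_(u : T) degree e u.

Definition regular_graph (T : finType) (e : rel T) : Prop :=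
  exists k : nat, forall u : T, degree e u = k.

Definition zagreb1 (T : finType) (e : rel T) : nat :=
  \sum_(u : T) degree e u ^ 2.

Local Open Scope ring_scope.

(* Edges are unordered pairs a = [set u; v], so d_u d_v and d_u + d_v are
   written as the product and the sum of the degrees over the elements of a
   (see [ga_term_edge]). *)
Definition ga_term (R : rcfType) (T : finType) (e : rel T) (a : {set T}) : R :=
  2 * Num.sqrt (\prod_(u in a) (degree e u)%:R)
    / \sum_(u in a) (degree e u)%:R.

Definition GA1 (R : rcfType) (T : finType) (e : rel T) : R :=
  \sum_(a in edge_set e) ga_term R e a.

Lemma ga_term_edge (R : rcfType) (T : finType) (e : rel T) (u v : T) :
  irreflexive e -> e u v ->
  ga_term R e [set u; v] =
    2 * Num.sqrt ((degree e u)%:R * (degree e v)%:R)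
      / ((degree e u)%:R + (degree e v)%:R).
Proof.
move=> irr_e euv.
have neq_uv : u \notin [set v].
  by rewrite inE; apply/eqP => equv; rewrite equv irr_e in euv.
by rewrite /ga_term !big_setU1 //= !big_set1.
Qed.

Lemma min_degree_le (T : finType) (e : rel T) (u : T) :
  (min_degree e <= degree e u)%N.
Proof.
rewrite /min_degree; have := mem_index_enum u.
elim: (index_enum T) => // x s IHs; rewrite inE big_cons geq_min.
by case/predU1P => [->|/IHs ->]; rewrite ?leqnn ?orbT.
Qed.

Lemma min_degree_attained (T : finType) (e : rel T) (u0 : T) :
  exists u, min_degree e = degree e u.
Proof.
have [u _ minu] := arg_minnP (degree e) (erefl : xpredT u0).
exists u; apply/eqP; rewrite eqn_leq min_degree_le /=.
rewrite /min_degree; elim/big_ind: _ => [|x y ux uy|v _].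
- exact: max_card.
- by rewrite leq_min ux uy.
- exact: minu.
Qed.

(* Main.v *)
Require Import Defs.
From mathcomp Require Import all_boot all_order all_algebra.
From mathcomp Require Import ring lra.

Import Order.TTheory GRing.Theory Num.Theory.

Local Open Scope ring_scope.

(** Let [m] be the number of edges, so that [2 m] is the sum of the degrees.
    Each term of [GA1] lies between [delta / Delta] and [1] (AM-GM), whence
    [delta m / Delta <= GA1 <= m].  On the left, [M1 <= 2 m Delta] because
    [d_u ^ 2 <= Delta d_u]; on the right, [(2 m) ^ 2 <= n M1] by Cauchy-Schwarz.
    Equality in either bound forces equality in the degree-sum inequality
    behind it, and hence regularity; connectedness gives [0 < delta]. *)

Section Graph.

Variables (T : finType) (e : rel T).

Lemma edge_setP (a : {set T}) :
  reflect (exists u v, e u v /\ a = [set u; v]) (a \in edge_set e).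
Proof.
rewrite inE; apply: (iffP existsP) => [[u /existsP[v /andP[euv /eqP->]]]|].
  by exists u, v.
by move=> [u [v [euv ->]]]; exists u; apply/existsP; exists v; rewrite euv eqxx.
Qed.

Lemma card_edge (a : {set T}) :
  irreflexive e -> a \in edge_set e -> #|a| = 2%N.
Proof.
move=> irr_e /edge_setP[u [v [euv ->]]]; rewrite cards2.
by case: eqVneq euv => // ->; rewrite irr_e.
Qed.

(** Sending a neighbour [v] of [u] to [[set u; v]] is a bijection onto the edges through [u]. It is
    injective because there are no loops: [v] lies in [[set u; w]] and differs from [u], so
    [v = w]. *)
Lemma card_incident_edges (u : T) :
  simple_graph e -> #|[set a in edge_set e | u \in a]| = degree e u.
Proof.
move=> [sym_e irr_e]; rewrite /degree.
have inj_pair : {in [set v | e u v] &, injective (fun v => [set u; v])}.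
  move=> v w; rewrite !inE => euv euw /setP/(_ v).
  rewrite !inE eqxx orbT => /esym/orP[/eqP vu|/eqP //].
  by rewrite vu irr_e in euv.
rewrite -(card_in_imset inj_pair); apply: eq_card => a; rewrite inE.
apply/andP/imsetP => [[/edge_setP[x [y [exy ->]]]]|[v]].
  rewrite !inE => /orP[/eqP->|/eqP->]; first by exists y; rewrite ?inE.
  by exists x; rewrite ?inE 1?sym_e // setUC.
rewrite inE => euv ->; split; last by rewrite !inE eqxx.
by apply/edge_setP; exists u, v.
Qed.

(** Double counting of the pairs of a vertex and an edge containing it: by vertices these give the
    degrees, by edges two for each edge. *)
Lemma handshake :
  simple_graph e -> (\sum_(u : T) degree e u = 2 * #|edge_set e|)%N.
Proof.
move=> e_simple; have [_ irr_e] := e_simple.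
transitivity (\sum_(u : T) \sum_(a in edge_set e) (u \in a))%N.
  apply: eq_bigr => u _; rewrite -card_incident_edges // -sum1dep_card.
  by rewrite big_mkcondr; apply: eq_bigr => a _; case: (u \in a).
rewrite exchange_big /= mulnC -sum_nat_const; apply: eq_bigr => a aE.
rewrite -(card_edge _ irr_e aE) -sum1_card [RHS]big_mkcond.
by apply: eq_bigr => u _; case: (u \in a).
Qed.

(** One of the two ends of any edge differs from [u]; the first step of a path from [u] to it
    reaches a neighbour of [u]. *)
Lemma connected_degree_gt0 (u : T) :
  simple_graph e -> connected_graph e -> edge_set e != set0 ->
  (0 < degree e u)%N.
Proof.
move=> [sym_e irr_e] conn_e /set0Pn[_ /edge_setP[x [y [exy _]]]].
have [w neq_uw] : exists w, u != w.
  case: (eqVneq u x) => [->|]; last by exists x.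
  by exists y; apply: contraTneq exy => ->; rewrite irr_e.
have /connectP[[|v p] /=] := conn_e u w.
  by move=> _ wu; rewrite wu eqxx in neq_uw.
by move=> /andP[euv _] _; apply/card_gt0P; exists v; rewrite inE.
Qed.

Lemma degree_le_max (u : T) : (degree e u <= max_degree e)%N.
Proof. exact: (leq_bigmax u). Qed.

End Graph.

(** The variance identity, with deviations scaled by [n] so that no division occurs. It yields both
    Cauchy-Schwarz against the constant 1 and its equality case. *)
Lemma sum_sqr_dev (R : comPzRingType) (T : finType) (f : T -> R) :
  let n : R := #|T|%:R in
  \sum_u (n * f u - \sum_v f v) ^+ 2 =
    n * (n * \sum_u f u ^+ 2 - (\sum_u f u) ^+ 2).
Proof.
move=> n; set S := \sum_v f v.
have sqrE u : (n * f u - S) ^+ 2 =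
    n ^+ 2 * f u ^+ 2 + (- (2 * n * S) * f u + S ^+ 2) by ring.
under eq_bigr do rewrite sqrE.
rewrite !big_split /= -!mulr_sumr sumr_const -mulr_natl -/S -/n; ring.
Qed.

Section Cauchy.

Variables (R : realDomainType) (T : finType) (f : T -> R).

Lemma sqr_sum_le : (\sum_u f u) ^+ 2 <= #|T|%:R * \sum_u f u ^+ 2.
Proof.
(* The identity only bounds [n] times the wanted difference, so [n] must be positive to be
   cancelled; the empty type is treated apart. *)
have [T0|Tgt0] := posnP #|T|.
  rewrite T0 mul0r big_pred0 ?expr0n // => u.
  by have := fintype0 u T0.
rewrite -subr_ge0 -(pmulr_rge0 _ (_ : 0 < #|T|%:R)) ?ltr0n // -sum_sqr_dev.
by apply: sumr_ge0 => u _; apply: sqr_ge0.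
Qed.

(** Equality makes the sum of squared deviations vanish, hence each deviation: every value of [f] is
    the mean. *)
Lemma sqr_sum_eq (u v : T) :
  (\sum_w f w) ^+ 2 = #|T|%:R * \sum_w f w ^+ 2 -> f u = f v.
Proof.
move=> eqS; have := sum_sqr_dev _ _ f; rewrite /= -eqS subrr mulr0.
move/eqP; rewrite psumr_eq0 => [/allP dev0|w _]; last exact: sqr_ge0.
have dev w : #|T|%:R * f w = \sum_w f w.
  have := dev0 w (mem_index_enum w).
  by rewrite /= sqrf_eq0 subr_eq0 => /eqP.
apply: (@mulfI _ (#|T|%:R : R)); last by rewrite !dev.
by rewrite pnatr_eq0 -lt0n; apply/card_gt0P; exists u.
Qed.

End Cauchy.

Section GeometricArithmetic.

Variables (R : rcfType) (T : finType) (e : rel T).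
Hypotheses (e_simple : simple_graph e) (deg_gt0 : forall u, (0 < degree e u)%N).

(** AM-GM, obtained by expanding the square of [Num.sqrt x - Num.sqrt y]. *)
Lemma ga_term_le1 (a : {set T}) : a \in edge_set e -> ga_term R e a <= 1.
Proof.
have [_ irr_e] := e_simple.
move=> /edge_setP[u [v [euv ->]]]; rewrite ga_term_edge //.
have du : 0 < (degree e u)%:R :> R by rewrite ltr0n.
have dv : 0 < (degree e v)%:R :> R by rewrite ltr0n.
rewrite ler_pdivrMr ?addr_gt0 // mul1r.
move: du dv; move: (degree e u)%:R (degree e v)%:R => x y x0 y0.
have := sqr_ge0 (Num.sqrt x - Num.sqrt y).
rewrite (sqrtrM _ (ltW x0)) sqrrB (sqr_sqrtr (ltW x0)) (sqr_sqrtr (ltW y0)); lra.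
Qed.

(** The term is the geometric mean of the two end degrees, at least delta, over their arithmetic
    mean, at most Delta. *)
Lemma ga_term_ge (a : {set T}) : a \in edge_set e ->
  (min_degree e)%:R / (max_degree e)%:R <= ga_term R e a.
Proof.
have [_ irr_e] := e_simple.
move=> /edge_setP[u [v [euv ->]]]; rewrite ga_term_edge //.
have du : 0 < (degree e u)%:R :> R by rewrite ltr0n.
have dv : 0 < (degree e v)%:R :> R by rewrite ltr0n.
have ux : (degree e u)%:R <= (max_degree e)%:R :> R by rewrite ler_nat degree_le_max.
have vx : (degree e v)%:R <= (max_degree e)%:R :> R by rewrite ler_nat degree_le_max.
have un : (min_degree e)%:R <= (degree e u)%:R :> R by rewrite ler_nat min_degree_le.
have vn : (min_degree e)%:R <= (degree e v)%:R :> R by rewrite ler_nat min_degree_le.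
have n0 : 0 <= (min_degree e)%:R :> R by rewrite ler0n.
move: du dv ux vx un vn n0; move: (degree e u)%:R (degree e v)%:R => x y.
move: (min_degree e)%:R (max_degree e)%:R => d D x0 y0 xD yD dx dy d0.
have D0 : 0 < D by exact: lt_le_trans xD.
have sqrt_ge : d <= Num.sqrt (x * y).
  rewrite -[leLHS]ger0_norm // -sqrtr_sqr ler_wsqrtr // expr2.
  exact: ler_pM.
rewrite ler_pdivrMr // mulrAC ler_pdivlMr ?addr_gt0 //.
apply: (@le_trans _ _ (d * (2 * D))); first by rewrite ler_wpM2l //; lra.
rewrite [leRHS](_ : _ = Num.sqrt (x * y) * (2 * D)); last by ring.
by rewrite ler_pM2r // mulr_gt0.
Qed.

Lemma ga_term_regular (k : nat) (a : {set T}) :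
  (forall u, degree e u = k) -> a \in edge_set e -> ga_term R e a = 1.
Proof.
have [_ irr_e] := e_simple.
move=> reg /edge_setP[u [v [euv ->]]]; have := deg_gt0 u.
rewrite ga_term_edge // !reg => k0.
rewrite -expr2 sqrtr_sqr ger0_norm ?ler0n // -mulr2n mulr_natl divff //.
by rewrite mulrn_eq0 pnatr_eq0 /= -lt0n.
Qed.

Lemma GA1_le : GA1 R e <= #|edge_set e|%:R.
Proof. by rewrite -sumr_const; apply: ler_sum => a /ga_term_le1. Qed.

Lemma GA1_ge :
  (min_degree e)%:R / (max_degree e)%:R * #|edge_set e|%:R <= GA1 R e.
Proof. by rewrite mulr_natr -sumr_const; apply: ler_sum => a /ga_term_ge. Qed.

Lemma GA1_regular (k : nat) :
  (forall u, degree e u = k) -> GA1 R e = #|edge_set e|%:R.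
Proof.
by move=> reg; rewrite -sumr_const; apply: eq_bigr => a /(ga_term_regular _ _ reg).
Qed.

End GeometricArithmetic.

Section Zagreb.

Variables (T : finType) (e : rel T).

(** Summing [d ^ 2 <= Delta * d] over the vertices keeps track of equality, which holds termwise
    exactly when [d] is 0 or Delta. *)
Lemma zagreb1_leif :
  (zagreb1 e <= max_degree e * \sum_u degree e u
     ?= iff [forall u, (degree e u == 0) || (degree e u == max_degree e)])%N.
Proof.
rewrite big_distrr /=; apply: leqif_sum => u _; rewrite expnS expn1.
split; first by rewrite leq_mul2r degree_le_max orbT.
by rewrite eqn_mul2r.
Qed.

End Zagreb.

Theorem theorem2p1 (R : rcfType) (T : finType) (e : rel T)
    (e_simple : simple_graph e)
    (e_connected : connected_graph e)
    (e_has_edge : edge_set e != set0) :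
  let n : R := #|T|%:R in
  let Delta : R := (max_degree e)%:R in
  let delta : R := (min_degree e)%:R in
  let M1 : R := (zagreb1 e)%:R in
  let GA : R := GA1 R e in
  [/\ delta * M1 / (2 * Delta ^+ 2) <= GA,
      GA <= Num.sqrt (n * M1) / 2,
      delta * M1 / (2 * Delta ^+ 2) = GA <-> regular_graph e
    & GA = Num.sqrt (n * M1) / 2 <-> regular_graph e].
Proof.
move=> n Delta delta M1 GA.
have deg_gt0 u := connected_degree_gt0 _ _ u e_simple e_connected e_has_edge.
have [x0 _] : exists x0 : T, true.
  by have /set0Pn[_ /edge_setP[x [_ _]]] := e_has_edge; exists x.
have delta_gt0 : 0 < delta.
  by have [u eq_min] := min_degree_attained e x0; rewrite ltr0n eq_min.
have Delta_gt0 : 0 < Delta.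
  by rewrite ltr0n (leq_trans (deg_gt0 x0)) ?degree_le_max.
pose m : R := #|edge_set e|%:R.
have sum_deg : \sum_u (degree e u)%:R = 2 * m.
  by rewrite -natr_sum handshake // natrM.
have M1E : M1 = \sum_u (degree e u)%:R ^+ 2.
  by rewrite /M1 /zagreb1 natr_sum; apply: eq_bigr => u _; rewrite natrX.
have GA_le : GA <= m by exact: GA1_le.
have GA_ge : delta / Delta * m <= GA by exact: GA1_ge.
have m_ge0 : 0 <= m by rewrite ler0n.
have M1_le : M1 <= Delta * (2 * m).
  by rewrite -sum_deg -natr_sum -natrM ler_nat zagreb1_leif.
have left_le : delta * M1 / (2 * Delta ^+ 2) <= delta / Delta * m.
  rewrite ler_pdivrMr ?mulr_gt0 ?exprn_gt0 //.
  rewrite [leRHS](_ : _ = delta * (Delta * (2 * m))); last by field; lra.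
  by rewrite ler_pM2l.
have sqrt_ge : 2 * m <= Num.sqrt (n * M1).
  rewrite -[leLHS]ger0_norm ?mulr_ge0 // -sqrtr_sqr ler_wsqrtr //.
  by rewrite -sum_deg M1E sqr_sum_le.
(* For a [k]-regular graph every quantity is a function of [n] and [k], which reduces both converse
   directions to algebra. *)
have regE k : (forall u, degree e u = k) ->
    [/\ GA = m, n * k%:R = 2 * m, M1 = n * k%:R ^+ 2,
        delta = k%:R & Delta = k%:R].
  move=> reg; split; first exact: GA1_regular reg.
  - rewrite -sum_deg; under eq_bigr do rewrite reg.
    by rewrite sumr_const mulr_natl.
  - rewrite M1E; under eq_bigr do rewrite reg.
    by rewrite sumr_const mulr_natl.
  - by have [u] := min_degree_attained e x0; rewrite /delta => ->; rewrite reg.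
  - rewrite /Delta /max_degree; congr _%:R.
    apply/eqP; rewrite eqn_leq -{2}(reg x0) degree_le_max andbT.
    by apply/bigmax_leqP => u _; rewrite reg.
split; [lra | lra | split | split].
- move=> eq_left.
  (* Equality collapses the chain through [delta / Delta * m]; cancelling the positive [delta] shows
     that the bound on [M1] is attained. *)
  have eqM : M1 = Delta * (2 * m).
    apply: (mulfI (lt0r_neq0 delta_gt0)).
    have : delta * M1 / (2 * Delta ^+ 2) = delta / Delta * m by lra.
    move/(canRL (mulfVK _)) => ->; last by rewrite ?mulf_neq0 ?expf_neq0; lra.
    by field; lra.
  exists (max_degree e) => u; apply/eqP.
  have : (zagreb1 e == max_degree e * \sum_u degree e u)%N.
    by rewrite -(eqr_nat R) natrM natr_sum sum_deg -/M1 eqM.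
  (* Attainment leaves degree 0 or Delta at each vertex, and positivity of the degrees excludes
     0. *)
  rewrite zagreb1_leif => /forallP/(_ u).
  by rewrite eqn0Ngt deg_gt0.
- move=> [k reg]; have [-> nk M1k dk Dk] := regE k reg.
  have k0 : k%:R != 0 :> R by rewrite -dk lt0r_neq0.
  rewrite M1k dk Dk; have -> : m = n * k%:R / 2 by lra.
  by field.
- move=> eq_right; exists (degree e x0) => u; apply/eqP.
  rewrite -(eqr_nat R); apply/eqP.
  apply: (@sqr_sum_eq R T (fun u => (degree e u)%:R)).
  (* The chain [GA <= m <= Num.sqrt (n * M1) / 2] collapses, which is equality in Cauchy-Schwarz for
     the degrees. *)
  have sqrtE : 2 * m = Num.sqrt (n * M1) by lra.
  by rewrite sum_deg sqrtE sqr_sqrtr ?mulr_ge0 ?ler0n // M1E.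
- move=> [k reg]; have [-> nk M1k _ _] := regE k reg.
  have -> : n * M1 = (2 * m) ^+ 2 by rewrite M1k -nk; ring.
  by rewrite sqrtr_sqr ger0_norm ?mulr_ge0 //; lra.
Qed.
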